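(* Let $\mathcal P=\mathcal T(E)/(R)$ be a nonsymmetric Koszul operad over $k$ with quadratic presentation $(E,R)$. Then the thin-quadratic box operad $\mathrm{Mor}(\mathcal P)$ is not Koszul, i.e. its Koszul complex $\mathrm{Mor}(\mathcal P)^{¡}\mathbin{\square}_\kappa \mathrm{Mor}(\mathcal P)$ is not acyclic.
   Context: **Box operads.** $k$ is a field of characteristic $0$; dg modules are homologically graded, with Koszul signs; homological degrees of the given data are nonnegative. An $\mathbb N^3$-dg module is a family $M=(M(p,q,r))_{p,q,r\in\mathbb N}$ of dg $k$-modules; $(p,q,r)$ is called an arity. A dg box operad $B$ is an $\mathbb N^3$-dg module with composition chain maps $\mu:B(p,n,r)\otimes\bigotimes_{i=1}^n B(p_{i-1},q_i,p_i)\to B(p+p_0,\sum_i q_i,r+p_n)$ for all $n\ge 0$ and all indices (for $n=0$: a map $\mu_{p_0}:B(p,0,r)\to B(p+p_0,0,r+p_0)$ for every $p_0\ge0$) and a unit $1\in B(0,1,0)$, such that $\mu(x;\mu(x_1;x^1_1,\dots),\dots,\mu(x_n;x^n_1,\dots))=\pm\mu(\mu(x;x_1,\dots,x_n);x_1^1,\dots)$ (Koszul sign) whenever arities match, and $\mu(x;1,\dots,1)=x=\mu(1;x)$. Graded (or ungraded) modules are dg modules with zero differential. **Stackings.** Let $\mathsf{Box}$ be the $\mathbb N^3$-coloured symmetric operad in sets governing box operads: it is generated by operations $C^{p_0,\dots,p_n;p,r}_{q_1,\dots,q_n}$ with inputs $(p,n,r),(p_0,q_1,p_1),\dots,(p_{n-1},q_n,p_n)$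 and output $(p+p_0,\sum q_i,r+p_n)$, and a constant $\eta$ with output $(0,1,0)$, subject to the following relations, for formal inputs $x$ of colour $(p,n,r)$, $x_i$ of colour $(p_{i-1},m_i,p_i)$ ($1\le i\le n$) and $x^i_j$ of colour $(p^i_{j-1},q^i_j,p^i_j)$ ($1\le j\le m_i$) with $p^i_{m_i}=p^{i+1}_0$, where $C$ denotes in each place the generator with the evident indices: $C(x;C(x_1;x^1_1,\dots,x^1_{m_1}),\dots,C(x_n;x^n_1,\dots,x^n_{m_n}))=C(C(x;x_1,\dots,x_n);x^1_1,\dots,x^n_{m_n})$ (for $n=0$: $C^{b;p+a,r+a}\circ_1C^{a;p,r}=C^{a+b;p,r}$), and $C^{0,\dots,0;p,r}_{1,\dots,1}(x;\eta,\dots,\eta)=x=C^{p,r;0,0}_n(\eta;x)$. An operation $S$ with $n$ inputs is a stacking of $n$ boxes, inducing $\mu_S(x_1,\dots,x_n)$ in any box operad. $S$ has an underlying planar rooted tree (in a generator the first box is the root and the others its children from left to right; $\eta$ is the trivial tree; composition is substitution); $S$ is in standard order if boxes are numbered in preorder. $S$ also has a wiring graph: in a generator, the lower $p$ incoming wires enter the root box and its $r$ outgoing wires are the lower outgoing wires; the upper $p_0$ incoming wires enter box $1$, the $p_i$ outgoing wires of box $i$ enter box $i+1$, the $p_n$ outgoing wires of box $n$ are the upper outgoing wires (if $n=0$, $p_0$ wires pass straight through); composition is substitution. Connected components of the wiring graph include isolated boxes and wires passing straight through. An arity is thin if $p=r=0$, semi-thin if exactly one of $p,r$ is $0$, non-thin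 if $p,r>0$. A stacking $S$ is thin-quadratic if it has no semi-thin boxes, is in standard order, its wiring graph has exactly two components, and it is of one of the types: (I) $S$ consists of exactly two thin boxes; (II) two boxes, the root non-thin and the upper one thin; (III) the root is thin and all other boxes are non-thin, and the output is not thin. **Free and cofree.** $\mathcal T(M)$ is the free box operad, spanned by $(S;x_1,\dots,x_n)$, $S$ a stacking in standard order, $x_i\in M$. $\mathcal T^c(M)$ is the same module with the decomposition dual to substitution of stackings (conilpotent cofree box cooperad). $M\mathbin{\square}_{(1)}M\subseteq\mathcal T(M)=\mathcal T^c(M)$ is spanned by the $(S;\dots)$ with $S$ thin-quadratic. A box cooperad $C$ has decompositions $\Delta_S:C\to\bigotimes_iC(p_i,q_i,r_i)$ for every stacking $S$ with boxes $(p_i,q_i,r_i)$. The free nonsymmetric operad $\mathcal T(E)$ is viewed as concentrated in thin arities, operad arity $q$ corresponding to $(0,q,0)$. **Thin (de)suspension.** $s_{\rm thin}^{\pm1}M$ is $M$ with the thin arities $(0,q,0)$ shifted by $s^{\pm1}$, other arities unchanged. For a conilpotent box cooperad $C$, $\Delta_{(1)}:s^{-1}_{\rm thin}C\to s^{-1}_{\rm thin}C\mathbin{\square}_{(1)}s^{-1}_{\rm thin}C$ is $\Delta_{(1)}(s^{-1}_{\rm thin}c)=\sum_S\varepsilon_S\,(S;s^{-1}_{\rm thin}c_{(1)},\dots,s^{-1}_{\rm thin}c_{(n)})$ over thin-quadratic $S$, $\Delta_S(c)=\sum c_{(1)}\otimes\cdots\otimes c_{(n)}$, with $\varepsilon_S=(-1)^{|c_{(1)}|+1},(-1)^{|c_{(1)}|},-1$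 for types I, II, III. **Twisted complex.** The box composite is $(M\mathbin{\square}M')(p,q,r)=\bigoplus M(p',n,r')\otimes\bigotimes_{i=1}^nM'(p_{i-1},q_i,p_i)$ over $n\ge0$, $q=\sum q_i$, $p=p'+p_0$, $r=r'+p_n$. For a degree $0$ map $\alpha:s^{-1}_{\rm thin}C\to B$ let $d_\alpha^r$ on $s^{-1}_{\rm thin}C\mathbin{\square}B$ be: apply $\Delta_{(1)}$ to the bottom element, apply $\alpha$ to all resulting factors except the root, then compose these with the upper elements of $B$ (using units of $B$ where inputs of the root are free). For $C,B$ with zero differential and $\alpha$ twisting, $C\mathbin{\square}_\alpha B=(s^{-1}_{\rm thin}C\mathbin{\square}B,d^r_\alpha)$. It is acyclic if its homology is $k$, spanned by the class of $(s^{-1}1;1)$ in arity $(0,1,0)$. **Koszulness.** A thin-quadratic box operad is $B=\mathcal T(E')/(R')$ with $R'\subseteq E'\mathbin{\square}_{(1)}E'$ ($(R')$ the box operadic ideal generated by $R'$). Let $s^2_{\rm thin}R'\subseteq s_{\rm thin}E'\mathbin{\square}_{(1)}s_{\rm thin}E'$ be the image of $R'$ under $(S;x_1,\dots,x_n)\mapsto\pm(S;s_{\rm thin}x_1,\dots,s_{\rm thin}x_n)$, sign $(-1)^{|x_1|+1},(-1)^{|x_1|},-1$ for types I, II, III. The Koszul dual box cooperad $B^{¡}$ is the largest box subcooperad of $\mathcal T^c(s_{\rm thin}E')$ on which the composite $\mathcal T^c(s_{\rm thin}E')\twoheadrightarrow (s_{\rm thin}E'\mathbin{\square}_{(1)}s_{\rm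 thin}E')/s^2_{\rm thin}R'$ vanishes. $\kappa:s^{-1}_{\rm thin}B^{¡}\to B$ is the projection onto $s^{-1}_{\rm thin}s_{\rm thin}E'=E'$ followed by $E'\to B$. $B$ is Koszul if the Koszul complex $B^{¡}\mathbin{\square}_\kappa B$ is acyclic. **$\mathrm{Mor}(\mathcal P)$.** The box operad generated by $E$ (with $e\in E(q)$ in arity $(0,q,0)$) and one element $f$ of arity $(1,1,1)$ and degree $0$, subject to the relations $R$ and $\mu(f;e)=\mu(e;f,\dots,f)$ ($q$ copies of $f$; for $q=0$ the right side is $\mu_1(e)$) for every $e\in E(q)$, $q\geq 0$. It is given this thin-quadratic presentation. *)

(* Defs.v *)
From HB Require Import structures.
From mathcomp Require Import all_boot all_order all_algebra.
From mathcomp Require Import boolp classical_sets cardinality fsbigop.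

Set Implicit Arguments.
Unset Strict Implicit.
Unset Printing Implicit Defensive.

Import GRing.Theory.
Local Open Scope ring_scope.
Local Open Scope classical_set_scope.

Definition arity : Type := (nat * nat * nat)%type.

Definition thin (a : arity) : bool :=
  let: (p, _, r) := a in (p == 0%N) && (r == 0%N).
Definition nonthin (a : arity) : bool :=
  let: (p, _, r) := a in (0 < p)%N && (0 < r)%N.
Definition semithin (a : arity) : bool := ~~ thin a && ~~ nonthin a.

(** [tree X] carries the normal forms of the composites of the generators
    [C] and [eta] of Box, with inputs labelled by [X] (box numbers follow the
    preorder, i.e. the standard order): [Leaf] is [eta], and
    [Node x p0 [:: T1; ...; Tn]] is [C(x; T1, ..., Tn)] with [x] an input.
    [p0] is the number of wires entering [T1] from the left; it is determined
    by [T1] if [0 < n], but is genuine data (the [p0] of [mu_p0]) if [n = 0].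
    [nf_complete] and [nf_onto] below identify this with the
    presentation of Box by generators and relations. *)
Inductive tree (X : Type) : Type :=
| Leaf
| Node of X & nat & seq (tree X).
Arguments Leaf {X}.
Arguments Node {X} _ _ _.

HB.instance Definition _ (X : Type) := gen_eqMixin (tree X).
HB.instance Definition _ (X : Type) := gen_choiceMixin (tree X).

Section Trees.
Context {X : Type} (ar : X -> arity).
Implicit Types (T : tree X) (Ts Us : seq (tree X)).

Fixpoint labels T : seq X :=
  if T is Node x _ Ts then x :: flatten [seq labels U | U <- Ts] else [::].

Definition nboxes T : nat := size (labels T).

(** The output [(lw T, nl T, rw T)] of a tree. *)
Definition lw T : nat := if T is Node x p0 _ then ((ar x).1.1 + p0)%N else 0%N.

Fixpoint rw T : nat :=
  if T is Node x p0 Ts then ((ar x).2 + last p0 [seq rw U | U <- Ts])%N else 0%N.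

Fixpoint nl T : nat :=
  if T is Node _ _ Ts then sumn [seq nl U | U <- Ts] else 1%N.

Definition out T : arity := (lw T, nl T, rw T).

(** The colours match: the wires leaving [Ti] are those entering [T(i+1)]. *)
Fixpoint wf T : bool :=
  if T is Node x p0 Ts then
    [&& size Ts == (ar x).1.2, all wf Ts
      & [seq lw U | U <- Ts] == belast p0 [seq rw U | U <- Ts]]
  else true.

Definition corolla (x : X) : tree X := Node x 0 (nseq (ar x).1.2 Leaf).

(** [graft T p0 Us] is [C(T; Us)]; [grafts Ts p0 Us] distributes [Us] over the
    inputs of the successive [Ts], [p0] being the number of wires entering the
    first of the [Us] from the left. *)
Fixpoint graft T (p0 : nat) Us {struct T} : tree X :=
  match T with
  | Leaf => head Leaf Us
  | Node x a Ts =>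
      let fix grafts Ts p Us :=
        if Ts is T :: Ts' then
          let U := take (nl T) Us in
          graft T p U :: grafts Ts' (last p [seq rw V | V <- U]) (drop (nl T) Us)
        else [::] in
      Node x (a + p0)%N (grafts Ts p0 Us)
  end.

Fixpoint grafts Ts (p : nat) Us : seq (tree X) :=
  if Ts is T :: Ts' then
    let U := take (nl T) Us in
    graft T p U :: grafts Ts' (last p [seq rw V | V <- U]) (drop (nl T) Us)
  else [::].

(** Koszul sign exponents for labels of degree [w]: [graft_sgn T Us] is for the
    permutation carrying the labels of [T], then those of the [Us], to the
    preorder of [graft T p0 Us]. *)
Variable w : X -> nat.

Definition tdeg T : nat := sumn [seq w x | x <- labels T].
Definition tdegs Ts : nat := sumn [seq tdeg T | T <- Ts].

Fixpoint graft_sgn T Us {struct T} : nat :=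
  match T with
  | Leaf => 0%N
  | Node _ _ Ts =>
      let fix grafts_sgn Ts Us :=
        if Ts is T :: Ts' then
          let U := take (nl T) Us in
          (graft_sgn T U + tdegs Ts' * tdegs U + grafts_sgn Ts' (drop (nl T) Us))%N
        else 0%N in
      grafts_sgn Ts Us
  end.

Fixpoint grafts_sgn Ts Us : nat :=
  if Ts is T :: Ts' then
    let U := take (nl T) Us in
    (graft_sgn T U + tdegs Ts' * tdegs U + grafts_sgn Ts' (drop (nl T) Us))%N
  else 0%N.

End Trees.

Fixpoint tmap (X Y : Type) (f : X -> Y) (T : tree X) : tree Y :=
  if T is Node x p0 Ts then Node (f x) p0 [seq tmap f U | U <- Ts] else Leaf.

Definition stacking : Type := tree arity.
Implicit Types S : stacking.

Notation boxes := (@labels arity).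
Notation sout := (@out arity id).
Notation swf := (@wf arity id).

(** [C^{p0,..,pn;p,r}_{q1,..,qn}] with root of arity [a] and upper boxes [s]. *)
Definition gen (a : arity) (p0 : nat) (s : seq arity) : stacking :=
  Node a p0 [seq corolla id b | b <- s].

Section Substitution.
Context {X : Type} (ar : X -> arity) (w : X -> nat).
Implicit Types us : seq (tree X).

(** [subst S us] is [S(u1, ..., un)]. *)
Fixpoint subst S us {struct S} : tree X :=
  match S with
  | Leaf => Leaf
  | Node _ p0 Ss =>
      let fix substs Ss us :=
        if Ss is S1 :: Ss' then
          subst S1 (take (nboxes S1) us) :: substs Ss' (drop (nboxes S1) us)
        else [::] in
      graft ar (head Leaf us) p0 (substs Ss (behead us))
  end.

Fixpoint substs (Ss : seq stacking) us : seq (tree X) :=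
  if Ss is S1 :: Ss' then
    subst S1 (take (nboxes S1) us) :: substs Ss' (drop (nboxes S1) us)
  else [::].

Fixpoint subst_sgn S us {struct S} : nat :=
  match S with
  | Leaf => 0%N
  | Node _ _ Ss =>
      let fix substs_sgn Ss us :=
        if Ss is S1 :: Ss' then
          (subst_sgn S1 (take (nboxes S1) us)
           + substs_sgn Ss' (drop (nboxes S1) us))%N
        else 0%N in
      (substs_sgn Ss (behead us)
       + graft_sgn w (head Leaf us) (substs Ss (behead us)))%N
  end.

End Substitution.

(** Formal composites of the generators; of the indices of a generator only
    [p0] has to be recorded, the others being read off from its arguments. *)
Inductive expr (X : Type) : Type :=
| Var of X
| Eta
| Comp of nat & expr X & seq (expr X).
Arguments Var {X} _.
Arguments Eta {X}.
Arguments Comp {X} _ _ _.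

Section Presentation.
Context {X : Type} (ar : X -> arity).
Implicit Types (e x : expr X) (es xs : seq (expr X)) (T : tree X).

Fixpoint elw e : nat :=
  match e with
  | Var x => (ar x).1.1 | Eta => 0%N | Comp p0 e _ => (elw e + p0)%N
  end.
Fixpoint erw e : nat :=
  match e with
  | Var x => (ar x).2 | Eta => 0%N
  | Comp p0 e es => (erw e + last p0 [seq erw x | x <- es])%N
  end.
Fixpoint enl e : nat :=
  match e with
  | Var x => (ar x).1.2 | Eta => 1%N
  | Comp _ _ es => sumn [seq enl x | x <- es]
  end.
Fixpoint ewf e : bool :=
  match e with
  | Var _ | Eta => true
  | Comp p0 e es =>
      [&& ewf e, size es == enl e, all ewf es
        & [seq elw x | x <- es] == belast p0 [seq erw x | x <- es]]
  end.

(** [[:: C(x1; x^1_1, ...); ...; C(xn; x^n_1, ...)]], with [p] wires entering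
    [x^1_1] from the left. *)
Fixpoint comps (p : nat) es (xss : seq (seq (expr X))) : seq (expr X) :=
  match es, xss with
  | e :: es', xs :: xss' =>
      Comp p e xs :: comps (last p [seq erw x | x <- xs]) es' xss'
  | _, _ => [::]
  end.

Inductive boxeq : expr X -> expr X -> Prop :=
| boxeq_refl e : boxeq e e
| boxeq_sym e e' : boxeq e e' -> boxeq e' e
| boxeq_trans e e' e'' : boxeq e e' -> boxeq e' e'' -> boxeq e e''
| boxeq_root p e e' es : boxeq e e' -> boxeq (Comp p e es) (Comp p e' es)
| boxeq_upper p e es x x' xs : boxeq x x' ->
    boxeq (Comp p e (es ++ x :: xs)) (Comp p e (es ++ x' :: xs))
| boxeq_assoc p q e es xss :
    [seq size xs | xs <- xss] = [seq enl x | x <- es] ->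
    ewf (Comp q (Comp p e es) (flatten xss)) ->
    boxeq (Comp (p + q) e (comps q es xss))
          (Comp q (Comp p e es) (flatten xss))
| boxeq_unitr e : ewf e -> boxeq (Comp 0 e (nseq (enl e) Eta)) e
| boxeq_unitl e : ewf e -> boxeq (Comp (elw e) Eta [:: e]) e.

Fixpoint nf e : tree X :=
  match e with
  | Var x => corolla ar x
  | Eta => Leaf
  | Comp p0 e es => graft ar (nf e) p0 [seq nf x | x <- es]
  end.

End Presentation.

Section NormalForms.
Context {X : Type} (ar : X -> arity).
Implicit Types (T U : tree X) (Ts Us Ws : seq (tree X)).
Local Open Scope nat_scope.

Let lws Us := [seq lw ar U | U <- Us].
Let rws Us := [seq rw ar U | U <- Us].
Let nls Us := sumn [seq nl U | U <- Us].
Let linked p Us := lws Us = belast p (rws Us).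

Fixpoint tree_rect_all (P : tree X -> Prop) (HL : P Leaf)
    (HN : forall x p Ts, foldr (fun T => and (P T)) True Ts -> P (Node x p Ts)) T : P T :=
  match T with
  | Leaf => HL
  | Node x p Ts => HN x p Ts
      ((fix go Ts : foldr (fun T => and (P T)) True Ts :=
          if Ts is T :: Ts' then conj (tree_rect_all HL HN T) (go Ts') else I) Ts)
  end.

Lemma graftE x a Ts p Us :
  graft ar (Node x a Ts) p Us = Node x (a + p) (grafts ar Ts p Us).
Proof. by []. Qed.

Let cut Us n m : size Us = n + m ->
  [/\ Us = take n Us ++ drop n Us, size (take n Us) = n & size (drop n Us) = m].
Proof.
by move=> h; rewrite cat_take_drop size_takel ?size_drop h ?addKn // leq_addr.
Qed.

Let last_drop n p Us : last (last p (rws (take n Us))) (rws (drop n Us)) = last p (rws Us).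
Proof. by rewrite -last_cat -map_cat cat_take_drop. Qed.

Let linked_cat p Us Ws : linked p (Us ++ Ws) ->
  linked p Us /\ linked (last p (rws Us)) Ws.
Proof.
rewrite /linked /lws /rws; elim: Us p => [|U Us IH] p //= [-> /IH[e1 e2]].
by rewrite e1.
Qed.

Let linked_cut n p Us : linked p Us ->
  linked p (take n Us) /\ linked (last p (rws (take n Us))) (drop n Us).
Proof. by move=> h; apply: linked_cat; rewrite cat_take_drop. Qed.

Let rw_grafts_aux Ts :
  foldr (fun T => and (forall p Us, size Us = nl T ->
     rw ar (graft ar T p Us) = rw ar T + last p (rws Us))) True Ts ->
  forall a p Us, size Us = nls Ts ->
  last (a + p) (rws (grafts ar Ts p Us)) = last a (rws Ts) + last p (rws Us).
Proof.
elim: Ts => [|T Ts IH] /=; first by move=> _ a p [].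
case=> hT hTs a p Us sz; have [eU s1 s2] := cut sz.
by rewrite hT // IH // last_drop.
Qed.

Lemma rw_graft T p Us : size Us = nl T ->
  rw ar (graft ar T p Us) = rw ar T + last p (rws Us).
Proof.
elim/tree_rect_all: T p Us => [|x a Ts IH] p Us; first by case: Us => [|U []].
by move=> sz; rewrite graftE /= -/(rws _) (rw_grafts_aux IH) // addnA.
Qed.

Lemma rw_grafts Ts a p Us : size Us = nls Ts ->
  last (a + p) (rws (grafts ar Ts p Us)) = last a (rws Ts) + last p (rws Us).
Proof.
apply: rw_grafts_aux; elim: Ts => //= T Ts IH; split=> // q Ws; exact: rw_graft.
Qed.

Lemma nl_graft T p Us : size Us = nl T -> nl (graft ar T p Us) = nls Us.
Proof.
elim/tree_rect_all: T p Us => [|x a Ts IH] p Us /=.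
  by case: Us => [|U []] //= _; rewrite /nls /= addn0.
elim: Ts IH p Us => [|T Ts IHs] /=; first by move=> _ p [].
case=> hT /IHs hTs p Us sz; have [eU s1 s2] := cut sz.
by rewrite hT // hTs // /nls -sumn_cat -map_cat -eU.
Qed.

Lemma nl_grafts Ts p Us : size Us = nls Ts -> nls (grafts ar Ts p Us) = nls Us.
Proof.
elim: Ts p Us => [|T Ts IH] p Us /=; first by case: Us.
move=> sz; have [eU s1 s2] := cut sz.
by rewrite [LHS]/nls /= nl_graft // -/(nls _) IH // /nls -sumn_cat -map_cat -eU.
Qed.

Lemma size_grafts Ts p Us : size (grafts ar Ts p Us) = size Ts.
Proof. by elim: Ts p Us => //= T Ts IH p Us; rewrite IH. Qed.

Lemma lw_graft T p Us : size Us = nl T -> linked p Us ->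
  lw ar (graft ar T p Us) = lw ar T + p.
Proof. by case: T => [|x a Ts] /=; [case: Us => [|U []] //= _ [->] | rewrite addnA]. Qed.

Lemma linked_grafts Ts a p Us : size Us = nls Ts -> linked a Ts -> linked p Us ->
  linked (a + p) (grafts ar Ts p Us).
Proof.
elim: Ts a p Us => [|T Ts IH] a p Us //= sz [eT lT] lU.
have [eU s1 s2] := cut sz; have [l1 l2] := linked_cut (nl T) lU.
by rewrite /linked /= lw_graft // eT rw_graft // -/(rws _) -/(lws _) (IH (rw ar T)).
Qed.

Lemma wf_graft T p Us : size Us = nl T -> linked p Us ->
  wf ar T -> all (wf ar) Us -> wf ar (graft ar T p Us).
Proof.
elim/tree_rect_all: T p Us => [|x a Ts IH] p Us.
  by case: Us => [|U []] //= _ _ _ /andP[].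
rewrite graftE /= => sz lU /and3P[/eqP sT wT /eqP lT] wU.
rewrite size_grafts sT eqxx /=; apply/andP; split; last by apply/eqP; exact: linked_grafts.
elim: Ts IH p Us {sT lT} wT sz lU wU => //= T Ts IHs [hT hTs] p Us /andP[wT wTs].
move=> sz lU wU; have [eU s1 s2] := cut sz; have [l1 l2] := linked_cut (nl T) lU.
by move: wU; rewrite eU all_cat -eU => /andP[w1 w2]; rewrite hT // IHs.
Qed.

Lemma grafts_cat Us1 Us2 q Ws1 Ws2 : size Ws1 = nls Us1 ->
  grafts ar (Us1 ++ Us2) q (Ws1 ++ Ws2) =
  grafts ar Us1 q Ws1 ++ grafts ar Us2 (last q (rws Ws1)) Ws2.
Proof.
elim: Us1 q Ws1 => [|U Us IH] q Ws1 /=; first by case: Ws1.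
move=> sz; have [eW s1 s2] := cut sz.
rewrite {1 2 3}eW -catA take_size_cat // drop_size_cat // IH //.
by rewrite last_drop.
Qed.

Let grafts_assoc_aux Ts :
  foldr (fun T => and (forall p Us q Ws, size Us = nl T -> size Ws = nls Us ->
     graft ar (graft ar T p Us) q Ws = graft ar T (p + q) (grafts ar Us q Ws)))
     True Ts ->
  forall p Us q Ws, size Us = nls Ts -> size Ws = nls Us ->
  grafts ar (grafts ar Ts p Us) q Ws = grafts ar Ts (p + q) (grafts ar Us q Ws).
Proof.
elim: Ts => //= T Ts IH [hT hTs] p Us q Ws sz; have [eU s1 s2] := cut sz.
move: (take _ _) (drop _ _) eU s1 s2 => U1 U2 -> s1 s2 {sz Us}.
rewrite /nls map_cat sumn_cat -!/(nls _) => szW; have [eW t1 t2] := cut szW.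
move: (take _ _) (drop _ _) eW t1 t2 => W1 W2 -> t1 t2 {szW Ws}.
rewrite /= nl_graft // !(take_size_cat _ t1, drop_size_cat _ t1) hT // grafts_cat //.
rewrite !(take_size_cat, drop_size_cat) ?size_grafts //.
by rewrite -!/(rws _) rw_grafts // IH.
Qed.

Lemma graft_assoc T p Us q Ws : size Us = nl T -> size Ws = nls Us ->
  graft ar (graft ar T p Us) q Ws = graft ar T (p + q) (grafts ar Us q Ws).
Proof.
elim/tree_rect_all: T p Us q Ws => [|x a Ts IH] p Us q Ws.
  case: Us => [|U []] //= _; rewrite /nls /= addn0 => <-.
  by rewrite take_size.
by move=> s1 s2; rewrite !graftE addnA (grafts_assoc_aux IH).
Qed.

Lemma graft_unit T : graft ar T 0 (nseq (nl T) Leaf) = T.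
Proof.
elim/tree_rect_all: T => // x a Ts IH; rewrite graftE addn0; congr Node.
elim: Ts IH => //= T Ts IHs [hT hTs].
rewrite nseqD take_size_cat ?size_nseq // drop_size_cat ?size_nseq // hT.
suff -> : last 0 (rws (nseq (nl T) Leaf)) = 0 by rewrite IHs.
by rewrite /rws map_nseq; elim: (nl T) => //= n.
Qed.

Fixpoint expr_rect_all (P : expr X -> Prop) (HV : forall x, P (Var x)) (HE : P Eta)
    (HC : forall p e es, P e -> foldr (fun e => and (P e)) True es -> P (Comp p e es))
    e : P e :=
  match e with
  | Var x => HV x
  | Eta => HE
  | Comp p e es => HC p e es (expr_rect_all HV HE HC e)
      ((fix go es : foldr (fun e => and (P e)) True es :=
          if es is e :: es' then conj (expr_rect_all HV HE HC e) (go es') else I) es)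
  end.

Lemma nf_wf e : ewf ar e ->
  wf ar (nf ar e) /\ out ar (nf ar e) = (elw ar e, enl ar e, erw ar e).
Proof.
elim/expr_rect_all: e => [x _||p e es IHe IHes] //=.
  rewrite /out /= size_nseq eqxx all_nseq orbT /= !map_nseq addn0.
  have -> : sumn (nseq (ar x).1.2 1) = (ar x).1.2 by rewrite sumn_nseq mul1n.
  have -> : last 0 (nseq (ar x).1.2 0) = 0 by elim: (_.2) => //= n.
  rewrite addn0; split=> //; apply/eqP; elim: (_.2) => //= n IH.
  by rewrite -IH.
case/and4P=> /IHe[we [e1 e2 e3]] /eqP sz wes /eqP lk.
have [w E] : all (wf ar) [seq nf ar x | x <- es] /\
    [seq out ar (nf ar x) | x <- es] = [seq (elw ar x, enl ar x, erw ar x) | x <- es].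
  elim: es IHes wes {sz lk} => //= x es IH [hx hes] /andP[/hx[wx ->] wes].
  by have [-> ->] := IH hes wes; rewrite wx.
have El : lws [seq nf ar x | x <- es] = [seq elw ar x | x <- es].
  by have := congr1 (map (fun a : arity => a.1.1)) E; rewrite /lws -!map_comp.
have Er : rws [seq nf ar x | x <- es] = [seq erw ar x | x <- es].
  by have := congr1 (map (fun a : arity => a.2)) E; rewrite /rws -!map_comp.
have En : nls [seq nf ar x | x <- es] = sumn [seq enl ar x | x <- es].
  by have := congr1 (map (fun a : arity => a.1.2)) E; rewrite /nls -!map_comp => ->.
have sz' : size [seq nf ar x | x <- es] = nl (nf ar e) by rewrite size_map e2.
have lk' : linked p [seq nf ar x | x <- es] by rewrite /linked El Er.
split; first exact: wf_graft.
by rewrite /out lw_graft // nl_graft // rw_graft // En Er e1 e3.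
Qed.

Lemma boxeq_sound e e' : boxeq ar e e' -> nf ar e = nf ar e'.
Proof.
elim=> {e e'} //=.
- by move=> e1 e2 e3 _ -> _ ->.
- by move=> p e e' es _ ->.
- by move=> p e es x x' xs _ E; rewrite !map_cat /= E.
- move=> p q e es xss Esz /and4P[/and4P[we /eqP sz wes lk] _ wxs _].
  have [_ [_ Ee _]] := nf_wf we.
  have Hes : all (ewf ar) es := wes.
  have Enl : [seq nl (nf ar x) | x <- es] = [seq enl ar x | x <- es].
    elim: es Hes {Esz sz wes lk} => //= x es IH /andP[/nf_wf[_ [_ -> _]] /IH ->] //.
  have Esz' : [seq size xs | xs <- xss] = [seq nl (nf ar x) | x <- es] by rewrite Enl.
  rewrite graft_assoc; last 2 first.
  + by rewrite size_map Ee.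
  + by rewrite size_map size_flatten /shape Esz' /nls -map_comp.
  congr graft.
  elim: es xss q Esz' wxs {Esz sz wes lk Enl Hes} => [|x es IH] [|xs xss] q //= [E1 E2].
  rewrite all_cat => /andP[w1 w2].
  rewrite map_cat take_size_cat ?size_map // drop_size_cat ?size_map // IH //.
  congr (_ :: grafts _ _ (last _ _) _).
  rewrite -map_comp; elim: xs w1 {E1} => //= y ys IHy /andP[/nf_wf[_ [_ _ ->]] /IHy ->] //.
- move=> e /nf_wf[_ [_ <- _]]; rewrite map_nseq; exact: graft_unit.
Qed.

Fixpoint quote T : expr X :=
  if T is Node x p Ts then Comp p (Var x) [seq quote U | U <- Ts] else Eta.

Let Forall_map (A B : Type) (f g : A -> B) s :
  foldr (fun x => and (f x = g x)) True s -> map f s = map g s.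
Proof. by elim: s => //= x s IH [-> /IH ->]. Qed.

Lemma quote_rw T : erw ar (quote T) = rw ar T.
Proof.
elim/tree_rect_all: T => // x p Ts IH /=; rewrite -map_comp.
by congr (_ + last _ _); apply: (Forall_map IH).
Qed.

Lemma quote_lw T : elw ar (quote T) = lw ar T.
Proof. by case: T. Qed.

Lemma quote_nl T : enl ar (quote T) = nl T.
Proof.
elim/tree_rect_all: T => // x p Ts IH /=; rewrite -map_comp.
by congr sumn; apply: (Forall_map IH).
Qed.

Let map_quote_rw Ts : [seq erw ar x | x <- [seq quote U | U <- Ts]] = rws Ts.
Proof. by rewrite -map_comp; apply: eq_map => T /=; rewrite quote_rw. Qed.
Let map_quote_lw Ts : [seq elw ar x | x <- [seq quote U | U <- Ts]] = lws Ts.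
Proof. by rewrite -map_comp; apply: eq_map => T /=; rewrite quote_lw. Qed.
Let map_quote_nl Ts : [seq enl ar x | x <- [seq quote U | U <- Ts]] = [seq nl U | U <- Ts].
Proof. by rewrite -map_comp; apply: eq_map => T /=; rewrite quote_nl. Qed.

Lemma quote_wf T : wf ar T -> ewf ar (quote T).
Proof.
elim/tree_rect_all: T => // x p Ts IH /= /and3P[/eqP sz wT /eqP lT].
rewrite size_map sz eqxx map_quote_lw map_quote_rw /lws lT eqxx andbT /=.
by elim: Ts IH wT {sz lT} => //= T Ts IHs [hT hTs] /andP[/hT -> /IHs ->].
Qed.

Let quotes_wf Ts : all (wf ar) Ts -> all (ewf ar) [seq quote U | U <- Ts].
Proof. by elim: Ts => //= T Ts IH /andP[/quote_wf -> /IH ->]. Qed.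

Let boxeq_uppers p e es xs xs' :
  size xs = size xs' ->
  (forall i, i < size xs -> boxeq ar (nth Eta xs i) (nth Eta xs' i)) ->
  boxeq ar (Comp p e (es ++ xs)) (Comp p e (es ++ xs')).
Proof.
elim: xs xs' es => [|x xs IH] [|x' xs'] es //=; first by constructor.
move=> [sz] H; apply: (boxeq_trans (boxeq_upper p e es xs (H 0 isT))).
by rewrite -!cat_rcons; apply: IH => // i Hi; apply: (H i.+1).
Qed.

Lemma quote_graft T p Us : size Us = nl T -> linked p Us ->
  wf ar T -> all (wf ar) Us ->
  boxeq ar (Comp p (quote T) [seq quote U | U <- Us]) (quote (graft ar T p Us)).
Proof.
elim/tree_rect_all: T p Us => [|x a Ts IH] p Us.
  case: Us => [|U []] //= _ [<-] _ /andP[wU _].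
  by rewrite -quote_lw; apply: boxeq_unitl; apply: quote_wf.
move=> sz lU wT wU; rewrite graftE [quote (Node _ _ _)]/=.
have wN := quote_wf wT; move: wT => /= /and3P[/eqP sT wTs /eqP lT].
pose xss := reshape [seq nl U | U <- Ts] [seq quote U | U <- Us].
have fl : flatten xss = [seq quote U | U <- Us].
  by rewrite reshapeKr // size_map sz.
have sh : [seq size xs | xs <- xss] = [seq nl U | U <- Ts].
  by rewrite [LHS]reshapeKl // size_map sz.
apply: boxeq_trans.
  apply: boxeq_sym; rewrite -fl; apply: boxeq_assoc; first by rewrite map_quote_nl.
  rewrite fl; apply/and4P; split=> //; last by rewrite map_quote_lw map_quote_rw; apply/eqP.
  - by rewrite size_map sz /= map_quote_nl.
  - exact: quotes_wf.
rewrite /xss; apply: (@boxeq_uppers _ _ [::]).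
  rewrite size_map size_grafts {fl sh xss sT lT wTs wN IH sz lU wU}.
  by elim: Ts Us p => //= T Ts IH Us p; rewrite -map_drop IH.
move=> {fl sh xss wN sT}.
elim: Ts IH p Us a {lT} sz lU wTs wU => //= T Ts IHs [hT hTs] p Us a sz lU /andP[wT wTs] wU.
have [eU s1 s2] := cut sz; have [l1 l2] := linked_cut (nl T) lU.
move: wU; rewrite eU all_cat -eU => /andP[w1 w2].
rewrite -map_take -map_drop map_quote_rw.
case=> [|i] /= Hi; first exact: hT.
exact: (IHs hTs).
Qed.

Lemma quote_corolla x : boxeq ar (quote (corolla ar x)) (Var x).
Proof.
by have := @boxeq_unitr _ ar (Var x) isT; rewrite /= map_nseq.
Qed.

Lemma quote_nf e : ewf ar e -> boxeq ar (quote (nf ar e)) e.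
Proof.
elim/expr_rect_all: e => [x _||p e es IHe IHes] /=; [exact: quote_corolla | by constructor |].
case/and4P=> we /eqP sz wes /eqP lk.
have [wne [_ ne _]] := nf_wf we.
have W : forall es, all (ewf ar) es -> [/\ all (wf ar) [seq nf ar x | x <- es],
    lws [seq nf ar x | x <- es] = [seq elw ar x | x <- es]
  & rws [seq nf ar x | x <- es] = [seq erw ar x | x <- es]].
  elim=> //= x xs IH /andP[/nf_wf[wx [ex _ fx]] /IH[-> -> ->]].
  by rewrite wx ex fx.
have [w1 w2 w3] := W _ wes.
apply: boxeq_trans.
  apply/boxeq_sym/quote_graft => //; first by rewrite size_map sz ne.
  by rewrite /linked w2 w3.
apply: boxeq_trans (boxeq_root p es (IHe we)).
apply: (@boxeq_uppers _ _ [::]); first by rewrite !size_map.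
rewrite !size_map; elim: es IHes wes {sz lk w1 w2 w3} => //= x es IH [hx hes] /andP[wx wes].
case=> [|i] Hi /=; [exact: hx | exact: IH].
Qed.

Theorem nf_complete e e' : ewf ar e -> ewf ar e' ->
  boxeq ar e e' <-> nf ar e = nf ar e'.
Proof.
move=> we we'; split; first exact: boxeq_sound.
move=> E; apply: boxeq_trans (quote_nf we'); rewrite -E.
exact/boxeq_sym/quote_nf.
Qed.

Theorem nf_onto T : wf ar T -> exists2 e, ewf ar e & nf ar e = T.
Proof.
move=> wT; exists (quote T); first exact: quote_wf.
elim/tree_rect_all: T wT => // x p Ts IH /= /and3P[/eqP sz wT lT].
have -> : [seq nf ar y | y <- [seq quote U | U <- Ts]] = Ts.
  elim: Ts IH wT {sz lT} => //= T Ts IHs [hT hTs] /andP[/hT -> /IHs ->] //.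
rewrite -sz add0n -/(grafts ar _ _ _); congr Node.
by elim: Ts p {x lT wT IH sz} => //= U Us IH p; rewrite take0 drop0 IH.
Qed.

End NormalForms.

(** A wire starts either outside ([inl i], the [i]-th incoming wire, counted
    from the lowest) or at a box ([inr j], the [j]-th box in preorder).
    [wiring S b ins] numbers the boxes of [S] from [b], feeds the wires [ins]
    into [S], and returns the pairs (start, box) for all wires entering a box,
    and the outgoing wires, from the lowest. *)
Definition source : Type := (nat + nat)%type.

Fixpoint wiring S (b : nat) (ins : seq source) {struct S} :
    seq (source * nat) * seq source :=
  match S with
  | Leaf => ([::], ins)
  | Node a _ Ss =>
      let fix row Ss b ins :=
        if Ss is T :: Ts then
          let: (e1, o1) := wiring T b ins in
          let: (e2, o2) := row Ts (b + nboxes T)%N o1 in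
          (e1 ++ e2, o2)
        else ([::], ins) in
      let: (e, o) := row Ss b.+1 (drop a.1.1 ins) in
      ([seq (s, b) | s <- take a.1.1 ins] ++ e, nseq a.2 (inr b) ++ o)
  end.

Definition wires_into S : seq (source * nat) :=
  (wiring S 0 [seq inl i | i <- iota 0 (lw id S)]).1.

(** The vertices are the incoming wires and the boxes, so that a wire passing
    straight through is an isolated vertex. *)
Definition vertex S : finType := ('I_(lw id S) + 'I_(nboxes S))%type.

Definition wired S (u v : vertex S) : bool :=
  match u, v with
  | inl i, inr j => (inl (i : nat), j : nat) \in wires_into S
  | inr i, inr j => (inr (i : nat), j : nat) \in wires_into S
  | _, inl _ => false
  end.

Definition ncomponents S : nat :=
  n_comp (fun u v : vertex S => wired u v || wired v u) predT.

Definition typeI S : bool := if boxes S is [:: a; b] then thin a && thin b else false.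
Definition typeII S : bool := if boxes S is [:: a; b] then nonthin a && thin b else false.
Definition typeIII S : bool :=
  if boxes S is a :: s then [&& thin a, all nonthin s & ~~ thin (sout S)] else false.

Definition thin_quadratic S : bool :=
  [&& swf S, ~~ has semithin (boxes S), ncomponents S == 2
    & [|| typeI S, typeII S | typeIII S]].

(** Box operads and nonsymmetric operads are treated uniformly: [adm] selects
    the stackings along which one may compose, [quad] the quadratic ones, and
    [(-1) ^+ qsgn S d] is the sign attached to a quadratic [S] whose root is
    decorated by an element of degree [d], both in the double suspension of the
    relations and in [Delta_(1)]. *)
Record kind := Kind {
  adm : pred stacking;
  quad : pred stacking;
  qsgn : stacking -> nat -> nat }.

Definition box_kind : kind :=
  {| adm := swf;
     quad := thin_quadratic;
     qsgn := fun S d => if typeI S then d.+1 else if typeII S then d else 1%N |}.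

(** A planar rooted tree is a stacking of thin boxes of thin output: it has no
    wires at all. For nonsymmetric operads quadratic means two vertices, and
    the signs are those of the usual [s^2 R] and of [c1 o_(1) kappa c2] with
    [kappa] of degree [-1]. *)
Definition planar S : bool := [&& swf S, all thin (boxes S) & thin (sout S)].

Definition ns_kind : kind :=
  {| adm := planar;
     quad := fun S => planar S && (nboxes S == 2);
     qsgn := fun _ d => d |}.

Section Linear.
Context {k : fieldType}.

Definition submodule (X : Type) (W : set (X -> k)) : Prop :=
  W (fun=> 0) /\ forall a u v, W u -> W v -> W (fun x => a * u x + v x).

Definition lspan (X : Type) (A : set (X -> k)) : set (X -> k) :=
  [set v | forall W, submodule W -> A `<=` W -> W v].

Definition delta (X : Type) (x : X) : X -> k := fun y => (`[< y = x >])%:R.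

Fixpoint ptens (X : Type) (cs : seq (X -> k)) (us : seq X) : k :=
  match cs, us with
  | [::], [::] => 1
  | c :: cs', u :: us' => c u * ptens cs' us'
  | _, _ => 0
  end.

Definition push (X Y : choiceType) (A : set X) (F : X -> Y) (v : X -> k) : Y -> k :=
  fun y => \sum_(x \in A `&` [set x | F x = y]) v x.

End Linear.

(** A graded [N^3]-module, as the direct sum of modules [gcomp i] placed in arity
    [gar i] and degree [gdeg i]. *)
Record gmod (k : fieldType) := GMod {
  gidx : Type;
  gar : gidx -> arity;
  gdeg : gidx -> nat;
  gcomp : gidx -> lmodType k }.
Arguments GMod {k gidx} _ _ _.

Definition label (k : fieldType) (M : gmod k) : Type := {i : gidx M & gcomp i}.
Definition inj (k : fieldType) (M : gmod k) (i : gidx M) (x : gcomp i) : label M :=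
  existT (@gcomp k M) i x.
Definition ltree (k : fieldType) (M : gmod k) : Type := tree (label M).

HB.instance Definition _ (k : fieldType) (M : gmod k) := Choice.on (ltree M).

Section Koszul.
Variables (k : fieldType) (Q : kind) (M : gmod k).

Let V : Type := ltree M -> k.

Definition lar (l : label M) : arity := gar (tag l).
Definition ldeg (l : label M) : nat := gdeg (tag l).
(** the degree in [s_thin M] *)
Definition sdeg (l : label M) : nat := (ldeg l + thin (lar l))%N.

Definition tshape (T : ltree M) : stacking := tmap lar T.
Definition ladm (T : ltree M) : bool := adm Q (tshape T).

(** [freemod a] is the free module on the pairs [(S; x1, ..., xn)], [S] admissible
    of output [a]; [T(M)(a)], and also [T^c(s_thin M)(a)], is its quotient by
    the multilinearity relations [mlin]. All the constructions below are carried
    out on representatives. *)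
Definition freemod (a : arity) : set V :=
  [set c | finite_set [set T | c T != 0]
           /\ forall T, c T != 0 -> ladm T /\ out lar T = a].

Inductive mlin3 (a : k) : ltree M -> ltree M -> ltree M -> Prop :=
| mlin3_root (i : gidx M) (x y : gcomp i) p Ts :
    mlin3 a (Node (inj (a *: x + y)) p Ts) (Node (inj x) p Ts) (Node (inj y) p Ts)
| mlin3_upper l p Ss T T1 T2 Us : mlin3 a T T1 T2 ->
    mlin3 a (Node l p (Ss ++ T :: Us))
            (Node l p (Ss ++ T1 :: Us)) (Node l p (Ss ++ T2 :: Us)).

Definition mlin : set V :=
  lspan [set c | exists a T T1 T2, [/\ mlin3 a T T1 T2, ladm T
    & c = fun U => delta T U - a * delta T1 U - delta T2 U]].

Definition matched S (us : seq (ltree M)) : bool :=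
  [&& adm Q S, [seq out lar u | u <- us] == boxes S & all ladm us].

(** [mu_S] on [T(M)], and the dual [Delta_S] on [T^c(s_thin M)]; tensors of
    elements of [V] are functions on sequences of trees. *)
Definition mu S (v : seq (ltree M) -> k) : V :=
  push [set us | matched S us] (subst lar S : seq (ltree M) -> ltree M)
    (fun us => (-1) ^+ subst_sgn lar ldeg S us * v us).

Definition Delta S (c : V) (us : seq (ltree M)) : k :=
  if matched S us then (-1) ^+ subst_sgn lar sdeg S us * c (subst lar S us) else 0.

(** Tensors of elements of arities [boxes S] becoming zero modulo [mlin]. *)
Definition mlin_tens S : set (seq (ltree M) -> k) :=
  lspan [set v | exists cs, [/\ v = ptens cs, size cs = nboxes S,
    forall i, (i < size cs)%N ->
      freemod (nth (0, 0, 0)%N (boxes S) i) (nth (fun=> 0) cs i)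
    & exists2 i, (i < size cs)%N & mlin (nth (fun=> 0) cs i)]].

Definition is_ideal (I : set V) : Prop :=
  [/\ submodule I, mlin `<=` I
    & forall S cs, adm Q S -> size cs = nboxes S ->
      (forall i, (i < size cs)%N ->
        freemod (nth (0, 0, 0)%N (boxes S) i) (nth (fun=> 0) cs i)) ->
      (exists2 i, (i < size cs)%N & I (nth (fun=> 0) cs i)) ->
      I (mu S (ptens cs))].

Definition ideal (R : set V) : set V :=
  [set c | forall I, is_ideal I -> R `<=` I -> I c].

Definition tensC (C : arity -> nat -> set V) S : set (seq (ltree M) -> k) :=
  lspan [set v | exists cs, [/\ v = ptens cs, size cs = nboxes S
    & forall i, (i < size cs)%N ->
      exists d, C (nth (0, 0, 0)%N (boxes S) i) d (nth (fun=> 0) cs i)]].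

(** [C a d], in arity [a] and degree [d], consists of representatives of the
    elements of a subcooperad of [T^c(s_thin M)]. *)
Definition subcooperad (C : arity -> nat -> set V) : Prop :=
  [/\ forall a d, submodule (C a d),
      forall a d c, C a d c ->
        freemod a c /\ forall T, c T != 0 -> tdeg sdeg T = d
    & forall S d c, adm Q S -> C (sout S) d c ->
        lspan (tensC C S `|` mlin_tens S) (Delta S c)].

Definition quad_part (c : V) : V := fun T => if quad Q (tshape T) then c T else 0.

Definition root_deg (w : label M -> nat) (T : ltree M) : nat :=
  if T is Node l _ _ then w l else 0%N.

Definition s2 (c : V) : V :=
  fun T => (-1) ^+ qsgn Q (tshape T) (root_deg ldeg T) * c T.

Definition kills (R : set V) (C : arity -> nat -> set V) : Prop :=
  forall a d c, C a d c -> lspan ([set s2 r | r in R] `|` mlin) (quad_part c).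

(** The largest subcooperad on which the projection to the quadratic part modulo
    [s2 R] vanishes is the sum of all of them; see [kdual_largest]. *)
Definition kdual (R : set V) (a : arity) (d : nat) : set V :=
  lspan [set c | exists C, [/\ subcooperad C, kills R C & C a d c]].

(** [(t, p0, ws)] stands for [(t; w1, ..., wn)] with [p0] wires entering [w1]
    from the left. *)
Let cell : choiceType := (ltree M * nat * seq (ltree M))%type.

Definition ptens_box (c : V) (p0 : nat) (cs : seq V) : cell -> k :=
  fun z => let: (t, q0, us) := z in c t * (q0 == p0)%:R * ptens cs us.

Definition is_cell_tensor (R : set V) (c : V) (p0 : nat) (cs : seq V) : Prop :=
  exists a d s, [/\ adm Q (gen a p0 s), kdual R a d c, size cs = size s
    & forall i, (i < size s)%N -> freemod (nth (0, 0, 0)%N s i) (nth (fun=> 0) cs i)].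

(** The Koszul complex is [kcx R / kcx0 R]. *)
Definition kcx (R : set V) : set (cell -> k) :=
  lspan [set z | exists c p0 cs, is_cell_tensor R c p0 cs /\ z = ptens_box c p0 cs].

Definition kcx0 (R : set V) : set (cell -> k) :=
  lspan [set z | exists c p0 cs, [/\ is_cell_tensor R c p0 cs, z = ptens_box c p0 cs
    & mlin c \/ exists2 i, (i < size cs)%N & ideal R (nth (fun=> 0) cs i)]].

(** An index [(S, us, p0, bs)] of the differential stands for the term in which
    the bottom element is decomposed as [S(u1, ..., un)] below [bs]. The twisting
    morphism [kappa] is nonzero only on trees with a single box and no wire
    passing by, which it sends to themselves (as [s_thin x |-> x]). *)
Let dindex : choiceType :=
  (stacking * seq (ltree M) * nat * seq (ltree M))%type.

Definition dindices : set dindex :=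
  [set i | let: (St, us, p0, bs) := i in
     quad Q St /\ forall u, u \in behead us -> exists l, u = corolla lar l].

Definition uppers S (us : seq (ltree M)) : seq (ltree M) :=
  if S is Node _ _ Ss then substs lar Ss (behead us) else [::].

Definition dtarget (i : dindex) : cell :=
  let: (St, us, p0, bs) := i in
  let s0 := if St is Node _ s0 _ then s0 else 0%N in
  (head Leaf us, (s0 + p0)%N, grafts lar (uppers St us) p0 bs).

(** The signs are, in turn, that of [Delta_(1)], that of [Delta_S] (within
    [Delta]) and the one for moving [bs] past [kappa(u2), ..., kappa(un)]. *)
Definition dcoef (z : cell -> k) (i : dindex) : k :=
  let: (St, us, p0, bs) := i in
  (-1) ^+ qsgn Q St (tdeg sdeg (head Leaf us))
  * (-1) ^+ grafts_sgn ldeg (uppers St us) bs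
  * Delta St (fun t => z (t, p0, bs)) us.

Definition dkappa (z : cell -> k) : cell -> k := push dindices dtarget (dcoef z).

Definition unit_cell : cell := (Leaf, 0%N, [:: Leaf]).

(** The homology is taken of the total complex, the direct sum over all arities
    and degrees. *)
Definition acyclic (R : set V) : Prop :=
  let boundary z := lspan ([set dkappa x | x in kcx R] `|` kcx0 R) z in
  let cycle z := kcx R z /\ kcx0 R (dkappa z) in
  [/\ cycle (delta unit_cell), ~ boundary (delta unit_cell)
    & forall z, cycle z ->
        exists a, boundary (fun x => z x - a * delta unit_cell x)].

End Koszul.

Section Largest.
Variables (k : fieldType) (Q : kind) (M : gmod k) (R : set (ltree M -> k)).

Lemma lspan_submodule (X : Type) (A : set (X -> k)) : submodule (lspan A).
Proof.
split=> [W [W0 _] _ //|a u v Au Av W WS AW].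
by case: (WS) => _; apply; [exact: Au | exact: Av].
Qed.

Lemma sub_lspan (X : Type) (A : set (X -> k)) : A `<=` lspan A.
Proof. by move=> u Au W _; apply. Qed.

Lemma lspan_mono (X : Type) (A B : set (X -> k)) : A `<=` B -> lspan A `<=` lspan B.
Proof. by move=> AB u Au W WS BW; apply: Au => // v /AB /BW. Qed.

(** A preimage of a submodule under a linear map. *)
Let preim_submodule (X Y : Type) (F : (X -> k) -> (Y -> k)) (W : set (Y -> k)) :
  F (fun=> 0) = (fun=> 0) ->
  (forall a u v, F (fun x => a * u x + v x) = fun y => a * F u y + F v y) ->
  submodule W -> submodule [set u | W (F u)].
Proof.
move=> F0 FD [W0 WD]; split=> [|a u v Wu Wv] /=; first by rewrite F0.
by rewrite FD; exact: WD.
Qed.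

Let homog_submodule a d : submodule [set c | freemod Q a c
  /\ forall T : ltree M, c T != 0 -> tdeg (@sdeg k M) T = d].
Proof.
split=> [|b u v [[fu hu] du] [[fv hv] dv]] /=.
  split=> [|T]; last by rewrite eqxx.
  split=> [|T]; last by rewrite eqxx.
  by apply: (sub_finite_set _ (finite_set0 _)) => T /=; rewrite eqxx.
have H T : b * u T + v T != 0 -> u T != 0 \/ v T != 0.
  have [->|] := eqVneq (u T) 0; last by left.
  by rewrite mulr0 add0r; right.
split=> [|T /H[/du|/dv] //]; split=> [|T /H[/hu|/hv] //].
apply: (@sub_finite_set _ _ ([set T | u T != 0] `|` [set T | v T != 0])).
  by move=> T /= /H.
by rewrite finite_setU.
Qed.

(** [kdual R] is the largest subcooperad killed by the projection. *)
Lemma kdual_largest :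
  [/\ subcooperad Q (kdual Q R), kills Q R (kdual Q R)
    & forall C, subcooperad Q C -> kills Q R C ->
        forall a d, C a d `<=` kdual Q R a d].
Proof.
have sub C : subcooperad Q C -> kills Q R C -> forall a d, C a d `<=` kdual Q R a d.
  by move=> cC kC a d c Cc; apply: sub_lspan; exists C.
split=> //.
- split=> [a d|a d c Kc|St d c aS Kc]; first exact: lspan_submodule.
  + apply: (Kc _ (homog_submodule a d)) => c' [C [[_ hC _] _ Cc']].
    exact: hC.
  + have Dlin : submodule [set c | lspan (tensC (kdual Q R) St `|` mlin_tens Q St)
                                       (Delta Q St c)].
      apply: preim_submodule; last exact: lspan_submodule.
      * by apply/funext => us; rewrite /Delta; case: ifP; rewrite ?mulr0.
      * move=> a u v; apply/funext => us; rewrite /Delta.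
        by case: ifP => _; rewrite ?mulr0 ?addr0 // mulrDr mulrCA.
    apply: (Kc _ Dlin) => c' [C [cC kC Cc']] /=; case: (cC) => _ _ /(_ St d c' aS Cc').
    apply: lspan_mono => v [Cv|]; [left | by right].
    move: Cv; apply: lspan_mono => w [cs [-> sz h]]; exists cs; split=> // i /h[e Ce].
    by exists e; apply: (sub _ cC kC).
- move=> a d c Kc.
  have Plin : submodule [set c | lspan ([set s2 Q r | r in R] `|` mlin Q (M:=M))
                                     (quad_part Q c)].
    apply: preim_submodule; last exact: lspan_submodule.
    + by apply/funext => T; rewrite /quad_part if_same.
    + move=> b u v; apply/funext => T; rewrite /quad_part.
      by case: ifP; rewrite ?mulr0 ?addr0.
  by apply: (Kc _ Plin) => c' [C [_ kC Cc']]; exact: kC Cc'.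
Qed.

End Largest.

Definition box_koszul (k : fieldType) (M : gmod k) (R : set (ltree M -> k)) : Prop :=
  acyclic box_kind R.

Section Mor.
Variables (k : fieldType) (E : nat -> nat -> lmodType k).

(** [E q d] is the degree [d] part of [E(q)], placed in arity [(0, q, 0)]. *)
Definition op_gmod : gmod k :=
  @GMod k (nat * nat) (fun i => (0, i.1, 0)%N) (fun i => i.2) (fun i => E i.1 i.2).

(** [R] is a set of homogeneous elements of the weight two part of [T(E)],
    spanning the graded submodule of relations. *)
Definition quadratic_relations (R : set (ltree op_gmod -> k)) : Prop :=
  forall r, R r -> exists q d,
    freemod ns_kind (0, q, 0)%N r
    /\ forall T, r T != 0 -> nboxes T = 2 /\ tdeg (@ldeg k op_gmod) T = d.

Definition ns_koszul (R : set (ltree op_gmod -> k)) : Prop :=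
  acyclic ns_kind R.

Definition mor_gmod : gmod k :=
  @GMod k (option (nat * nat))
    (fun i => if i is Some i then (0, i.1, 0)%N else (1, 1, 1)%N)
    (fun i => if i is Some i then i.2 else 0%N)
    (fun i => if i is Some i then E i.1 i.2 else (k^o : lmodType k)).

Definition mor_f : label mor_gmod := @inj k mor_gmod None (1 : k^o).
Definition mor_e (l : label op_gmod) : label mor_gmod :=
  @inj k mor_gmod (Some (tag l)) (tagged l).

Definition mor_incl (r : ltree op_gmod -> k) : ltree mor_gmod -> k :=
  push [set: ltree op_gmod] (tmap mor_e : ltree op_gmod -> ltree mor_gmod) r.

Definition mor_rel (R : set (ltree op_gmod -> k)) : set (ltree mor_gmod -> k) :=
  [set mor_incl r | r in R] `|`
  [set r | exists q d (e : E q d),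
     let f := corolla (@lar k mor_gmod) mor_f in
     let e' := mor_e (@inj k op_gmod (q, d) e) in
     let fe : ltree mor_gmod := Node mor_f 0 [:: corolla (@lar k mor_gmod) e'] in
     let ef : ltree mor_gmod := Node e' 1 (nseq q f) in
     r = fun T => delta fe T - delta ef T].

End Mor.

(* Main.v *)
(** Write [ff] for the two-fold composite of [f] in the Koszul dual cooperad; it
    lies there because a stacking of boxes of arity [(1, 1, 1)] is never
    thin-quadratic, so no relation constrains the cofree composites of [f]. In
    the Koszul complex [(ff; 1)] is a cycle: a decomposition of [ff] contributing
    to the differential would need both copies of [f] above a trivial root, and
    that stacking has three wiring components instead of two. It is not a
    boundary: in the terms of a boundary the upper level carries a generator of
    [Mor(P)], or is empty, but is never the unit alone, and this survives
    passing to the quotient by the relations, which involve no unit. *)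
Require Import Defs.
From mathcomp Require Import all_boot all_order all_algebra.
From mathcomp Require Import boolp classical_sets cardinality fsbigop.

Set Implicit Arguments.
Unset Strict Implicit.
Unset Printing Implicit Defensive.

Import GRing.Theory.
Local Open Scope ring_scope.

(** * Counting labels in grafted and substituted trees *)

Section Labels.
Context {X : Type} (ar : X -> arity).
Implicit Types (P : pred X) (T U : tree X) (S : stacking) (Ts Us : seq (tree X)).
Local Open Scope nat_scope.

(** The predicate stays free because two counts are used: that of all boxes ([predT]), and that of
    the boxes not labelled by [f]. *)
Definition nlab P T := count P (labels T).
Definition nlabs P Ts := sumn [seq nlab P T | T <- Ts].

Lemma nlab_node P x p Ts : nlab P (Node x p Ts) = P x + nlabs P Ts.
Proof.
rewrite /nlab /nlabs /=; congr (_ + _).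
by elim: Ts => //= T Ts IH; rewrite count_cat IH.
Qed.

Lemma nlabs_cat P Ts Us : nlabs P (Ts ++ Us) = nlabs P Ts + nlabs P Us.
Proof. by rewrite /nlabs map_cat sumn_cat. Qed.

(** Grafting only rearranges labels, provided that the number of grafted trees fits: surplus trees
    would be lost. *)
Lemma nlab_graft P T p Us : size Us = nl T ->
  nlab P (graft ar T p Us) = nlab P T + nlabs P Us.
Proof.
elim/(@tree_rect_all X): T p Us => [|x a Ts IH] p Us.
  by case: Us => [|U []] //= _; rewrite /nlabs /= addn0.
rewrite graftE !nlab_node -addnA => sz; congr (_ + _).
move: sz => /=; elim: Ts IH p Us => [|T Ts IHs] /=; first by move=> _ p [].
case=> hT hTs p Us sz.
have s1 : size (take (nl T) Us) = nl T by rewrite size_takel // sz leq_addr.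
have s2 : size (drop (nl T) Us) = sumn [seq nl U | U <- Ts] by rewrite size_drop sz addKn.
have := IHs hTs (last p [seq rw ar V | V <- take (nl T) Us]) _ s2.
rewrite /nlabs /= hT // -!/(nlabs _ _) => ->.
by rewrite -{3}(cat_take_drop (nl T) Us) nlabs_cat addnACA.
Qed.

Lemma nboxes_node x p Ts : nboxes (Node x p Ts) = (sumn [seq nboxes T | T <- Ts]).+1.
Proof. by rewrite /nboxes /= size_flatten /shape -map_comp. Qed.

Lemma nboxes_eq0 T : nboxes T = 0 -> T = Leaf.
Proof. by case: T. Qed.

Lemma size_substs Ss us : size (substs ar Ss us) = size Ss.
Proof. by elim: Ss us => //= S Ss IH us; rewrite IH. Qed.

Let fits (S : stacking) (us : seq (tree X)) := [seq nl u | u <- us] = [seq b.1.2 | b <- labels S].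

Let cut_fits (S : stacking) (Ss : seq stacking) (us : seq (tree X)) :
  [seq nl u | u <- us] = [seq b.1.2 | b <- labels S ++ flatten [seq labels S0 | S0 <- Ss]] ->
  fits S (take (nboxes S) us) /\
  [seq nl u | u <- drop (nboxes S) us] = [seq b.1.2 | b <- flatten [seq labels S0 | S0 <- Ss]].
Proof.
rewrite /fits map_cat map_take map_drop => ->; rewrite /nboxes.
by rewrite take_size_cat ?size_map // drop_size_cat ?size_map.
Qed.

Let subst_aux P (Ss : seq stacking) :
  foldr (fun S => and (forall us, wf id S -> fits S us ->
    nl (subst ar S us) = nl S /\ nlab P (subst ar S us) = nlabs P us)) True Ss ->
  forall us, all (wf id) Ss ->
  [seq nl u | u <- us] = [seq b.1.2 | b <- flatten [seq labels S0 | S0 <- Ss]] ->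
  [seq nl u | u <- substs ar Ss us] = [seq nl S0 | S0 <- Ss] /\
  nlabs P (substs ar Ss us) = nlabs P us.
Proof.
elim: Ss => [|S Ss IH] /=; first by move=> _ [].
case=> hS hSs us /andP[wS wSs] /cut_fits[f1 f2].
have [e1 e2] := hS _ wS f1; have [e3 e4] := IH hSs _ wSs f2.
rewrite e1 e3; split=> //.
by rewrite /nlabs /= e2 -!/(nlabs _ _) e4 -nlabs_cat cat_take_drop.
Qed.

(** At a node, the root is replaced by a tree with as many inputs as the node has children, so
    [nlab_graft] applies and the counts add up. *)
Lemma nl_nlab_subst P (S : stacking) us : wf id S ->
  [seq nl u | u <- us] = [seq b.1.2 | b <- labels S] ->
  nl (subst ar S us) = nl S /\ nlab P (subst ar S us) = nlabs P us.
Proof.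
elim/(@tree_rect_all arity): S us => [|b p Ss IH] us; first by case: us.
case: us => [|u us] //= /and3P[/eqP sz wSs _] [nu nus].
have [e1 e2] := subst_aux IH wSs nus.
have sz' : size (substs ar Ss us) = nl u by rewrite size_substs sz nu.
by rewrite -/(substs ar Ss us) nl_graft // nlab_graft // e1 e2.
Qed.

Lemma nlabs_substs P (Ss : seq stacking) us : all (wf id) Ss ->
  [seq nl u | u <- us] = [seq b.1.2 | b <- flatten [seq labels S0 | S0 <- Ss]] ->
  nlabs P (substs ar Ss us) = nlabs P us.
Proof.
move=> w n; have [] // := @subst_aux P Ss _ us w n.
by elim: Ss {w n} => //= S Ss IH; split=> // vs; apply: nl_nlab_subst.
Qed.

Lemma lw_tmap T : lw id (tmap ar T) = lw ar T.
Proof. by case: T. Qed.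

Lemma rw_tmap T : rw id (tmap ar T) = rw ar T.
Proof.
elim/(@tree_rect_all X): T => //= x p Ts IH; congr (_ + last _ _).
by elim: Ts IH => //= T Ts IHs [-> /IHs ->].
Qed.

Lemma wf_tmap T : wf id (tmap ar T) = wf ar T.
Proof.
elim/(@tree_rect_all X): T => //= x p Ts IH; rewrite size_map; congr [&& _, _ & _].
  by elim: Ts IH => //= T Ts IHs [-> /IHs ->].
rewrite -!map_comp; congr (_ == belast _ _); apply: eq_map => T /=.
  exact: lw_tmap.
exact: rw_tmap.
Qed.

Lemma labels_tmap (f : X -> arity) T : labels (tmap f T) = [seq f x | x <- labels T].
Proof.
elim/(@tree_rect_all X): T => //= x p Ts IH; congr (_ :: _).
by elim: Ts IH => //= T Ts IHs [-> /IHs ->]; rewrite map_cat.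
Qed.

Lemma graft_leaf T p Us : graft ar T p Us = Leaf -> T = Leaf.
Proof. by case: T. Qed.

End Labels.

(** * The wiring graph of two copies of [f] above a trivial root *)

Definition two_strands : stacking :=
  Node (0, 1, 0)%N 2 [:: Node (1, 1, 1)%N 1 [:: Node (1, 1, 1)%N 0 [:: Leaf]]].

Lemma ncomponents_two_strands : ncomponents two_strands != 2.
Proof.
(* Incoming wire [i] enters box [i + 1] and no wire joins two boxes. Hence [strand] is constant on
   components and separates the three boxes. *)
pose strand (v : vertex two_strands) : 'I_3 :=
  match v with inl i => inord i.+1 | inr j => inord j end.
rewrite /ncomponents; set e : rel (vertex two_strands) := (fun u v => _).
have inv u v : connect e u v -> strand u = strand v.
  case/connectP=> s; elim: s u => [|w s IH] u /=; first by move=> _ ->.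
  case/andP=> euw /IH H /H <-.
  case: u w euw {IH H} =>
      [[[|[|i]] //= ?]|[[|[|[|i]]] //= ?]] [[[|[|j]] //= ?]|[[|[|[|j]]] //= ?]];
    by rewrite /e /wired /wires_into /= ?inE /=.
have sg (j : 'I_3) : strand (inr j) = j by apply/val_inj; rewrite /= inordK.
suff : (#|'I_3| <= n_comp e predT)%N by rewrite card_ord; case: eqP => // ->.
pose g (j : 'I_3) := fingraph.root e (inr j : vertex two_strands).
have injg : injective g.
  move=> i j gij; rewrite -(sg i) -(sg j) (inv _ _ (connect_root e _)).
  by rewrite (inv (inr j) _ (connect_root e _)) -/(g i) gij.
rewrite -(card_codom injg) /n_comp_mem; apply/subset_leq_card/fintype.subsetP => v.
case/codomP=> j ->; rewrite !inE andbT; apply/roots_root/sym_connect_sym.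
by move=> u w; rewrite /e orbC.
Qed.

(** * Delta functions, their tensors and push-forwards *)

Section Deltas.
Context {k : fieldType}.

Lemma deltaE (X : Type) (x : X) : delta (k := k) x x = 1.
Proof. by rewrite /delta; case: asboolP. Qed.

Lemma delta_neq (X : Type) (x y : X) : y <> x -> delta (k := k) x y = 0.
Proof. by rewrite /delta; case: asboolP. Qed.

Lemma delta_neq0 (X : Type) (x y : X) : delta (k := k) x y != 0 -> y = x.
Proof. by rewrite /delta; case: asboolP => //; rewrite eqxx. Qed.

Lemma ptens_eq0 (X : Type) (x0 : X) (cs : seq (X -> k)) (us : seq X) i :
  (i < size cs)%N -> nth (fun=> 0) cs i (nth x0 us i) = 0 -> ptens cs us = 0.
Proof.
elim: cs us i => [|c cs IH] [|u us] [|i] //=; first by move=> _ ->; rewrite mul0r.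
by move=> lt e; rewrite (IH _ i) // mulr0.
Qed.

Lemma ptens_delta (X : Type) (us vs : seq X) :
  ptens [seq delta u : X -> k | u <- us] vs = delta us vs.
Proof.
elim: us vs => [|u us IH] [|v vs] /=; first by rewrite deltaE.
- by rewrite delta_neq.
- by rewrite delta_neq.
rewrite IH /delta -natrM mulnb; congr (nat_of_bool _)%:R.
by apply/andP/asboolP => [[/asboolP -> /asboolP ->] //|[-> ->]]; split; apply/asboolP.
Qed.

Lemma push0 (X Y : choiceType) (A : set X) (F : X -> Y) (v : X -> k) y :
  (forall x, A x -> F x = y -> v x = 0) -> push A F v y = 0.
Proof. by move=> h; apply: fsbig1 => x [Ax Fx]; apply: h. Qed.

Lemma submoduleZ (X : Type) (W : set (X -> k)) a u :
  submodule W -> W u -> W (fun x => a * u x).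
Proof.
move=> [W0 WD] Wu; have -> : (fun x => a * u x) = (fun x => a * u x + 0).
  by apply/funext => x; rewrite addr0.
exact: (WD a u (fun=> 0)).
Qed.

End Deltas.

(** * A linear functional that detects [ff] modulo multilinearity *)

Section Mlin.
Variables (k : fieldType) (E : nat -> nat -> lmodType k).
Notation M := (mor_gmod E).

Definition coef_f (l : label M) : k :=
  match l with
  | existT None x => x
  | existT (Some _) _ => 0
  end.

(** The product is linear in each label, hence compatible with [mlin]. The factor on the number of
    boxes excludes the trivial tree, whose empty product would be 1. *)
Definition coef_ff (T : ltree M) : k :=
  (nboxes T == 2)%:R * \prod_(l <- labels T) coef_f l.

Lemma mlin3_labels a (T T1 T2 : ltree M) : mlin3 a T T1 T2 ->
  exists i (x y : gcomp i) s t,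
    [/\ labels T = s ++ inj (M := M) (a *: x + y) :: t,
        labels T1 = s ++ inj (M := M) x :: t & labels T2 = s ++ inj (M := M) y :: t].
Proof.
elim=> [i x y p Ts|l p Ss U U1 U2 Us _ [i [x [y [s [t [e e1 e2]]]]]]] /=.
  by exists i, x, y, [::]; eexists.
exists i, x, y, (l :: flatten [seq labels V | V <- Ss] ++ s),
  (t ++ flatten [seq labels V | V <- Us]).
by rewrite !map_cat !flatten_cat /= e e1 e2 /= -!catA.
Qed.

Lemma coef_ff_mlin3 a (T T1 T2 : ltree M) : mlin3 a T T1 T2 ->
  coef_ff T = a * coef_ff T1 + coef_ff T2.
Proof.
case/mlin3_labels=> i [x [y [s [t [e e1 e2]]]]].
rewrite /coef_ff /nboxes e e1 e2 !size_cat /=.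
case: eqP => _; last by rewrite !mul0r mulr0 addr0.
rewrite !mul1r !big_cat !big_cons.
have -> : coef_f (inj (M := M) (a *: x + y)) =
    a * coef_f (inj (M := M) x) + coef_f (inj (M := M) y).
  by case: i x y {e e1 e2} => [i|] x y; rewrite /= ?mulr0 ?addr0.
by rewrite /= mulrDl mulrDr -mulrA [in LHS]mulrCA.
Qed.

(** The sum extending [coef_ff] to arbitrary functions on trees need not be finite, so its kernel is
    described through finite presentations by deltas. This is a submodule containing the generators
    of [mlin]. *)
Let comb0 (c : ltree M -> k) : Prop :=
  exists s : seq (k * ltree M), c = (fun U => \sum_(x <- s) x.1 * delta x.2 U) /\
    \sum_(x <- s) x.1 * coef_ff x.2 = 0.

Let sum_delta (r : seq (ltree M)) T (g : ltree M -> k) : uniq r -> T \in r ->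
  \sum_(U <- r) delta T U * g U = g T.
Proof.
move=> ur Tr; rewrite (bigD1_seq T) //= deltaE mul1r big1 ?addr0 // => U /eqP ne.
by rewrite delta_neq // mul0r.
Qed.

Lemma mlin_coef_ff Q (T U : ltree M) a :
  mlin Q (fun V => delta T V - a * delta U V) -> coef_ff T = a * coef_ff U.
Proof.
move=> /(_ comb0) h; have {h} [|c [b [V [V1 [V2 [m _ ->]]]]]|s [e e0]] := h.
- split=> [|b u v [s [-> es]] [t [-> et]]].
    by exists [::]; rewrite big_nil; split=> //; apply/funext => V; rewrite big_nil.
  exists ([seq (b * x.1, x.2) | x <- s] ++ t); split.
    apply/funext => V; rewrite big_cat big_map mulr_sumr; congr (_ + _).
    by apply: eq_bigr => x _; rewrite mulrA.
  rewrite big_cat big_map et /= addr0; under eq_bigr do rewrite -mulrA.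
  by rewrite -mulr_sumr es mulr0.
- exists [:: (1, V); (- b, V1); (-1, V2)]; split.
    by apply/funext => W; rewrite !big_cons big_nil /=; rewrite addr0 mul1r mulNr mulN1r addrA.
  by rewrite !big_cons big_nil /= (coef_ff_mlin3 m) mul1r mulNr mulN1r addr0 addrA
     [_ * _ + _]addrC addrK subrr.
(* A duplicate-free list of all trees involved. Summing both expressions of the same function
   against [coef_ff] over it shows that the value does not depend on the presentation. *)
pose r := undup [:: T, U & [seq x.2 | x <- s]].
have ur : uniq r by apply: undup_uniq.
have rT : T \in r by rewrite mem_undup inE eqxx.
have rU : U \in r by rewrite mem_undup !inE eqxx orbT.
apply/eqP; rewrite -subr_eq0 -e0; apply/eqP.
transitivity (\sum_(V <- r) (delta T V - a * delta U V) * coef_ff V).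
  under eq_bigr do rewrite mulrBl -mulrA.
  by rewrite sumrB -mulr_sumr !sum_delta.
under eq_bigr => V _ do rewrite (congr1 (fun g => g V) e) mulr_suml.
rewrite exchange_big /=; apply: eq_big_seq => x xs.
under eq_bigr do rewrite -mulrA.
by rewrite -mulr_sumr sum_delta // mem_undup !inE map_f ?orbT.
Qed.

End Mlin.

(** * Composites without boxes, and the upper level of the differential *)

Section BoxKind.
Variables (k : fieldType) (M : gmod k).
Local Open Scope nat_scope.
Local Open Scope classical_set_scope.

Lemma ladm_wf (T : ltree M) : ladm box_kind T = wf (@lar k M) T.
Proof. exact: wf_tmap. Qed.

Lemma nlab_matched (P : pred (label M)) (S : stacking) (us : seq (ltree M)) :
  matched box_kind S us -> nlab P (subst (@lar k M) S us) = nlabs P us.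
Proof.
case/and3P=> wS /eqP eS _; apply: (proj2 (nl_nlab_subst _ P wS _)).
by rewrite -eS -map_comp.
Qed.

Lemma nlabs_eq0 (P : pred (label M)) (us : seq (ltree M)) u :
  nlabs P us = 0 -> u \in us -> nlab P u = 0.
Proof.
elim: us => //= v us IH; rewrite /nlabs /= => /eqP; rewrite addn_eq0.
by case/andP=> /eqP v0 /eqP /IH h; rewrite inE => /orP[/eqP -> |/h].
Qed.

Lemma subst_leaf S (us : seq (ltree M)) u : matched box_kind S us ->
  subst (@lar k M) S us = Leaf -> u \in us -> u = Leaf.
Proof.
move=> m e; have := nlab_matched predT m; rewrite e => /esym n0 /(nlabs_eq0 n0).
by rewrite /nlab count_predT; apply: nboxes_eq0.
Qed.

(** An upper level equal to the unit leaves no label for the factors to which [kappa] is applied,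
    yet each of them carries one. So the stacking would be a single box below a leaf, which is not
    thin-quadratic. *)
Lemma dkappa_upper_leaf (z : ltree M * nat * seq (ltree M) -> k) t p :
  dkappa box_kind z (t, p, [:: Leaf]) = 0%R.
Proof.
apply: push0 => -[[[S us] p0] bs] [qS us1] [_ _ e].
apply/eqP/negP => /negP; rewrite /dcoef mulf_eq0 negb_or => /andP[_].
rewrite /Delta; case: ifP => [|_]; last by rewrite eqxx.
case/and3P=> /= wS /eqP eS _ _.
case: S wS eS e qS => [|a s Ss] //= /and3P[/eqP sz wSs /eqP lS].
case: us us1 => [|u us] //= us1 [ea eS] e qS.
have nus : nlabs predT us = 0.
  rewrite -(@nlabs_substs _ (@lar k M) predT Ss us wSs); last by rewrite -eS -map_comp.
  move: e; case: (substs _ _ _) => [|U [|U2 Us]] //= [/graft_leaf ->].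
  by [].
case: us us1 eS nus e => [|v us] us1 eS nus e; last first.
  have [l el] := us1 v (mem_head _ _).
  have := nlabs_eq0 nus (mem_head _ _).
  by rewrite el nlab_node.
have szS : size Ss = 1.
  by rewrite -(size_substs (@lar k M) Ss [::]) -(size_grafts (@lar k M) _ p0 bs) e.
case: Ss szS sz wSs lS eS qS {e} => [|U [|]] // _ sz _ + eS.
have -> : U = Leaf by apply: nboxes_eq0; move: eS; rewrite /= cats0 /nboxes => <-.
(* Only type III admits a single box. Below a leaf no wire can pass by a thin root, so the output is
   thin, contrary to that type. *)
move=> /= [<-] /and4P[_ _ _]; rewrite /typeI /typeII /typeIII /= /out /=.
case: a {ea sz us1 eS} => [[a1 a2] a3] /=; rewrite ?addn0.
by case: ((a1 == 0) && (a3 == 0)).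
Qed.

End BoxKind.

(** * The subcooperad of iterated composites of [f] *)

Section Chains.
Variables (k : fieldType) (E : nat -> nat -> lmodType k).
Notation M := (mor_gmod E).
Notation f := (mor_f E).
Local Open Scope nat_scope.
Local Open Scope classical_set_scope.

(** Of the incoming wires, the lowest enters the bottom [f] and the other [m] go to the chain
    above. *)
Fixpoint fchain (n : nat) : ltree M :=
  if n is m.+1 then Node f m [:: fchain m] else Leaf.

Lemma out_fchain n : out (@lar k M) (fchain n) = (n, 1, n).
Proof. by elim: n => //= n; rewrite /out /= => -[_ -> ->]. Qed.

Lemma wf_fchain n : wf (@lar k M) (fchain n).
Proof.
elim: n => //= n ->; have [-> _ _] := out_fchain n.
by rewrite /= !eqxx.
Qed.

Lemma labels_fchain n : labels (fchain n) = nseq n f.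
Proof. by elim: n => //= n ->; rewrite cats0. Qed.

Let nonf : pred (label M) := fun l => `[< l <> f >].

(** Since [f] has one input, the tree is a single branch, and well-formedness forces every [p0]. *)
Lemma fchainP T : wf (@lar k M) T -> nlab nonf T = 0 -> T = fchain (lw (@lar k M) T).
Proof.
elim/(@tree_rect_all (label M)): T => // x p Ts IH wT; rewrite nlab_node.
move=> /eqP; rewrite addn_eq0 => /andP[]; rewrite /nonf.
case: asboolP => // /contrapT ex _ /eqP n0; rewrite {x}ex in wT *.
case/and3P: wT; case: Ts IH n0 => [|U []] //= [IH _].
rewrite /nlabs /= addn0 andbT => n0 _ wU /eqP[eU].
by rewrite (IH wU n0) eU.
Qed.

(** Substitution preserves the number of labels different from [f], so every factor is again a
    chain, and its length fixes its arity. *)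
Lemma subst_fchain S (us : seq (ltree M)) n :
  matched box_kind S us -> subst (@lar k M) S us = fchain n ->
  us = [seq fchain b.1.1 | b <- boxes S] /\
  boxes S = [seq (b.1.1, 1, b.1.1) | b <- boxes S].
Proof.
move=> m e; have := nlab_matched nonf m; rewrite e.
have -> : nlab nonf (fchain n) = 0.
  rewrite /nlab labels_fchain count_nseq /nonf.
  by case: asboolP.
move=> /esym n0; case/and3P: m => _ /eqP eS wu.
have h u : u \in us -> fchain (lw (@lar k M) u) = u.
  move=> uin; apply/esym/fchainP; last exact: nlabs_eq0 uin.
  by rewrite -ladm_wf (allP wu).
rewrite -eS -!map_comp; split.
  by rewrite -[LHS](map_id us); apply/eq_in_map => u /h.
by apply/eq_in_map => u /h e' /=; rewrite -{1}e' out_fchain.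
Qed.

(** The span of the chains, stated as a condition on supports. The degree is 0 because [(1, 1, 1)]
    is not thin, so [s_thin] does not shift [f]. *)
Definition fchains (a : arity) (d : nat) : set (ltree M -> k) :=
  [set c | forall T, c T != 0%R -> [/\ d = 0, T = fchain a.1.1 & a = (a.1.1, 1, a.1.1)]].

Lemma fchains_delta n : fchains (n, 1, n) 0 (delta (fchain n)).
Proof. by move=> T nz; rewrite (delta_neq0 nz). Qed.

Lemma freemod_delta (T : ltree M) : wf (@lar k M) T ->
  freemod box_kind (out (@lar k M) T) (delta T).
Proof.
move=> wT; split; last by move=> U nz; rewrite (delta_neq0 nz) ladm_wf.
by apply: (sub_finite_set _ (finite_set1 T)) => U nz; apply: delta_neq0 nz.
Qed.

(** A chain has at most one decomposition along [S], so [Delta] yields a multiple of a single tensor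
    of chains. *)
Lemma subcooperad_fchains : subcooperad box_kind fchains.
Proof.
split=> [a d|a d c h|S d c wS h].
- split=> [T|x u v hu hv T]; first by rewrite eqxx.
  have [u0|/hu //] := eqVneq (u T) 0%R.
  by rewrite u0 mulr0 add0r => /hv.
- split; last first.
    move=> T /h[-> -> _]; rewrite /tdeg labels_fchain.
    by elim: a.1.1.
  split; first by apply: (sub_finite_set _ (finite_set1 (fchain a.1.1))) => T /h[].
  by move=> T /h[_ -> ea]; rewrite ladm_wf wf_fchain out_fchain -ea.
pose us := [seq fchain b.1.1 | b <- boxes S].
have us0 vs : Delta box_kind S c vs != 0%R ->
    [/\ d = 0, vs = us & boxes S = [seq (b.1.1, 1, b.1.1) | b <- boxes S]].
  rewrite /Delta; case: ifP => [m|_]; last by rewrite eqxx.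
  rewrite mulf_eq0 negb_or => /andP[_ /h[d0 e _]].
  by have [e1 e2] := subst_fchain m e.
have -> : Delta box_kind S c = (fun vs => Delta box_kind S c us * delta us vs + 0)%R.
  apply/funext => vs; rewrite addr0.
  have [->|ne] := EM (vs = us); first by rewrite deltaE mulr1.
  rewrite delta_neq // mulr0; apply/eqP/negP => /negP/us0[_ e _].
  exact: ne.
have [W0 WD] := lspan_submodule (tensC fchains S `|` mlin_tens (M := M) box_kind S).
have [->|/us0[d0 _ eS]] := eqVneq (Delta box_kind S c us) 0%R.
  rewrite (_ : (fun=> _) = (fun=> 0%R)) //.
  by apply/funext => vs; rewrite mul0r addr0.
apply: WD => //; apply: sub_lspan; left; apply: sub_lspan.
exists [seq delta u : ltree M -> k | u <- us]; split.
- by apply/funext => vs; rewrite ptens_delta.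
- by rewrite !size_map.
move=> i; rewrite !size_map => lt; exists 0.
rewrite (nth_map Leaf) ?size_map // (nth_map (0, 0, 0)) //.
have -> : nth (0, 0, 0) (boxes S) i =
    let m := (nth (0, 0, 0) (boxes S) i).1.1 in (m, 1, m).
  by rewrite {1}eS (nth_map (0, 0, 0)).
exact: fchains_delta.
Qed.

(** Each quadratic type contains a thin box, while all boxes of a chain have arity [(1, 1, 1)]. *)
Lemma quad_fchain n : thin_quadratic (tshape (fchain n)) = false.
Proof.
apply/negP => /and4P[_ _ _].
rewrite /typeI /typeII /typeIII /tshape labels_tmap labels_fchain map_nseq.
by case: n => [|[|[|n]]].
Qed.

Lemma kills_fchains (R : set (ltree M -> k)) : kills box_kind R fchains.
Proof.
move=> a d c h; have -> : quad_part box_kind c = (fun=> 0%R).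
  apply/funext => T; rewrite /quad_part; case: ifP => // q.
  by apply/eqP/negP => /negP/h[_ e _]; move: q; rewrite /= e quad_fchain.
by case: (lspan_submodule ([set s2 box_kind r | r in R] `|` mlin (M := M) box_kind)).
Qed.

Lemma kdual_fchain (R : set (ltree M -> k)) n :
  kdual box_kind R (n, 1, n) 0 (delta (fchain n)).
Proof.
have [_ _ h] := kdual_largest box_kind R.
exact: (h _ subcooperad_fchains (@kills_fchains R) _ _ _ (fchains_delta (n := n))).
Qed.

End Chains.

(** * The cycle built from [ff], and a constraint on boundaries *)

Section KoszulComplex.
Variables (k : fieldType) (E : nat -> nat -> lmodType k).
Notation M := (mor_gmod E).
Local Open Scope classical_set_scope.

Let ff : ltree M := fchain E 2.
Let ff_cell : ltree M * nat * seq (ltree M) := (ff, 0%N, [:: Leaf]).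

(** Vanishing at [Leaf] itself defines an ideal: a composite is [Leaf] only if all its factors are,
    and the multilinearity and operadic relations involve only trees with boxes. *)
Lemma ideal_leaf (R : set (ltree (op_gmod E) -> k)) (c : ltree M -> k) :
  quadratic_relations R -> ideal box_kind (mor_rel R) c -> c Leaf = 0.
Proof.
move=> quadR /(_ [set c | c Leaf = 0]); apply; first split.
- by split=> // a u v /= u0 v0; rewrite u0 v0 mulr0 addr0.
- move=> c' /(_ [set c | c Leaf = 0]); apply.
    by split=> // a u v /= u0 v0; rewrite u0 v0 mulr0 addr0.
  move=> _ [a [T [T1 [T2 [m _ ->]]]]] /=.
  by case: m => *; rewrite !delta_neq // mulr0 !subr0.
- move=> S cs wS sz _ [i lt ci] /=; apply: push0 => us m e.
  have szu : size us = nboxes S.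
    by case/and3P: (m) => _ /eqP eS _; rewrite /nboxes -eS size_map.
  rewrite (ptens_eq0 (x0 := Leaf) lt) ?mulr0 //.
  have -> : nth Leaf us i = Leaf; last exact: ci.
  by apply: (subst_leaf m e); apply: mem_nth; rewrite szu -sz.
move=> _ [[r /quadR[q [d [_ h]]] <-]|[q [d [e ->]]]] /=.
  apply: push0 => T _ eT; apply/eqP/negP => /negP/h[].
  by case: T eT.
by rewrite !delta_neq // subr0.
Qed.

Lemma kcx_ff_cell R : kcx box_kind R (delta ff_cell).
Proof.
apply: sub_lspan; exists (delta ff), 0%N, [:: delta Leaf]; split; last first.
  apply/funext => -[[t q] us]; rewrite /ptens_box.
  have [->|net] := EM (t = ff); last first.
    by rewrite (delta_neq net) !mul0r delta_neq // => -[].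
  rewrite deltaE mul1r; case: eqP => [->|neq]; last first.
    by rewrite mul0r delta_neq // => -[].
  rewrite mul1r [RHS](ptens_delta [:: Leaf]).
  have [->|neu] := EM (us = [:: Leaf]); first by rewrite !deltaE.
  by rewrite !delta_neq // => -[].
exists (2, 1, 2)%N, 0%N, [:: (0, 1, 0)%N]; split=> //; first exact: kdual_fchain.
by case=> // _; apply: (freemod_delta (T := Leaf)).
Qed.

(** The only decomposition that could contribute is [f] above [f] above the
    unit; its wiring graph has three components. *)
Lemma dkappa_ff_cell : dkappa box_kind (delta ff_cell) = (fun=> 0).
Proof.
apply/funext => y; apply: push0 => -[[[S us] p0] bs] [qS us1] _.
apply/eqP/negP => /negP; rewrite /dcoef mulf_eq0 negb_or => /andP[_].
rewrite /Delta; case: ifP => [m|_]; last by rewrite eqxx.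
rewrite mulf_eq0 negb_or => /andP[_ nz].
have [e _ _] : (subst (@lar k M) S us, p0, bs) = ff_cell by apply: delta_neq0 nz.
have [eus eS] := subst_fchain m e.
have := nlab_matched predT m; rewrite e /nlab count_predT labels_fchain size_nseq.
case/and4P: qS => wS _ nc ty; move: us1; rewrite eus.
case Sb: (boxes S) eS ty => [|b cs]; first by rewrite /typeI /typeII /typeIII Sb.
move=> /= [eb ebs] ty hbs.
(* A chain that is also a corolla has exactly one box, which determines the arity of every box above
   the root. *)
have {hbs ebs} ebs : cs = nseq (size cs) (1, 1, 1)%N.
  apply/all_pred1P/allP => x xbs /=.
  have ex : x = (x.1.1, 1, x.1.1)%N.
    by move: xbs; rewrite {1}ebs => /mapP[w _ ->].
  have [l /(congr1 (@nboxes _))] := hbs _ (map_f _ xbs).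
  rewrite {1}/nboxes labels_fchain size_nseq nboxes_node map_nseq sumn_nseq mul0n => x1.
  by rewrite ex x1.
(* Types I and II need a thin upper box, so type III remains and the root is thin. *)
have {ty} : b.1.1 = 0%N.
  move: ty; rewrite /typeI /typeII /typeIII Sb ebs eb /=.
  case: (size cs) => [|[|n]] /=; rewrite ?andbF /= ?orbF;
    by case/andP=> /andP[/eqP].
(* The root is decorated by the trivial tree, so the two copies of [f] account for exactly two upper
   boxes. *)
move=> b0; rewrite b0 in eb; rewrite b0 ebs map_nseq /nlabs /= map_nseq sumn_nseq.
rewrite mul1n => /esym cs2; rewrite [size cs]cs2 {cs2} in ebs.
rewrite {}eb {}ebs {b b0 cs eus} in Sb.
suff eS : S = two_strands by move: nc; rewrite eS (negPf ncomponents_two_strands).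
(* Every box has one input, so the stacking is a single branch, and well-formedness fixes its wire
   numbers. *)
case: S Sb wS {e nz m nc} => [|a s [|U [|U2 Us]]] //= [-> eU] //=.
case: U eU => [|a1 s1 [|U [|U2 Us]]] //= [-> eU] /=; rewrite ?andbF //.
case: U eU => [|a2 s2 [|U [|U2 Us]]] //= [-> eU] /=; rewrite ?andbF //.
rewrite (_ : U = Leaf); last first.
  by apply: nboxes_eq0; rewrite /nboxes; move: eU; rewrite !cats0 => ->.
by rewrite !andbT /= => /andP[/andP[/eqP[<-] /eqP[<-]] /eqP[<-]].
Qed.

(** The slice at upper level [[:: Leaf]] is linear in [z] and vanishes on images of [dkappa]. On a
    generator of [kcx0] it is a multiple of [c], where either [c] lies in [mlin] or the scalar is
    zero by [ideal_leaf]. *)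
Lemma upper_leaf_boundary (R : set (ltree (op_gmod E) -> k)) z :
  quadratic_relations R ->
  lspan ([set dkappa box_kind x | x in kcx (M := M) box_kind (mor_rel R)]
           `|` kcx0 (M := M) box_kind (mor_rel R)) z ->
  mlin box_kind (fun T => z (T, 0%N, [:: Leaf])).
Proof.
move=> quadR; have smlin : submodule (mlin (M := M) box_kind) := lspan_submodule _.
pose W := [set z : ltree M * nat * seq (ltree M) -> k |
  mlin box_kind (fun T => z (T, 0%N, [:: Leaf]))].
have sW : submodule W.
  by case: smlin => [W0 WD]; split=> [|a u v uW vW]; [exact: W0 | exact: WD].
move=> /(_ W sW); apply=> {}z [[x _ <-]|]; rewrite /W /=.
  rewrite (_ : (fun T => _) = (fun=> 0)); first by case: smlin.
  by apply/funext => T; rewrite dkappa_upper_leaf.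
move=> /(_ W sW); apply=> {}z [c [p0 [cs [_ -> h]]]]; rewrite /W /=.
pose a := (0%N == p0)%:R * ptens cs [:: (Leaf : ltree M)].
rewrite (_ : (fun T => _) = (fun T => a * c T)); last first.
  by apply/funext => T; rewrite /a [RHS]mulrC mulrA.
case: h => [|[i lt /ideal_leaf]]; first exact: submoduleZ.
move=> /(_ quadR) ci; have -> : a = 0.
  rewrite /a (ptens_eq0 (x0 := Leaf) lt) ?mulr0 //.
  (* The default [Leaf] of [nth] equals the only entry, so every index is covered. *)
  by case: i {lt} ci => [|[]].
by rewrite (_ : (fun T => _) = (fun=> 0)) //; [case: smlin | apply/funext => T; rewrite mul0r].
Qed.

End KoszulComplex.

Theorem theorem1p1 (k : fieldType) (char0 : [pchar k] =i pred0)
    (E : nat -> nat -> lmodType k)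
    (R : set (ltree (op_gmod E) -> k))
    (quadraticR : quadratic_relations R)
    (koszulP : ns_koszul R) :
  ~ box_koszul (mor_rel R).
Proof.
case=> _ _ /(_ (delta (fchain E 2, 0%N, [:: Leaf]))) [].
  split; first exact: kcx_ff_cell.
  by rewrite dkappa_ff_cell => W [].
(* The slice turns a homology with a multiple of the unit class into a relation modulo [mlin]
   between the two-fold chain and [Leaf]. *)
move=> a /(upper_leaf_boundary quadraticR); set g := (fun T => _).
have -> : g = (fun T => delta (fchain E 2) T - a * delta Leaf T).
  apply/funext => T; rewrite /g /delta /unit_cell.
  congr ((nat_of_bool _)%:R - a * (nat_of_bool _)%:R).
    by apply/asboolP/asboolP => [[]|->].
  by apply/asboolP/asboolP => [[]|->].
(* [coef_ff] is 1 on the two-fold chain and 0 on [Leaf], so the relation would give [1 = a * 0]. *)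
move/mlin_coef_ff; rewrite /coef_ff /nboxes !labels_fchain /= mul0r mulr0.
rewrite !big_cons big_nil !mulr1 => /eqP.
by rewrite oner_eq0.
Qed.
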